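(* Let $R$ be a commutative ring with $1\neq 0$ that is not quasilocal, and let $I$ be a proper ideal of $R$ such that $\mathrm{ann}(i)=\{r\in R : ri=0\}$ is not a maximal ideal of $R$ for every element $i\in I$. Then $I$ is a weakly 1-absorbing primary ideal of $R$ if and only if $I$ is a weakly primary ideal of $R$.
   Context: All rings are commutative with $1\neq 0$. A ring is quasilocal if it has exactly one maximal ideal. For an ideal $I$ of $R$, $\sqrt{I}=\{a\in R : a^n\in I \text{ for some positive integer } n\}$. A proper ideal $I$ of $R$ is called weakly 1-absorbing primary if whenever $a,b,c\in R$ are nonunit elements and $0\neq abc\in I$, then $ab\in I$ or $c\in\sqrt{I}$. A proper ideal $I$ of $R$ is called weakly primary if whenever $a,b\in R$ and $0\neq ab\in I$, then $a\in I$ or $b\in\sqrt{I}$. *)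

(* Defs.v *)
From mathcomp Require Import all_boot all_algebra.
From mathcomp Require Import boolp classical_sets.

Set Implicit Arguments.
Unset Strict Implicit.
Unset Printing Implicit Defensive.

Import GRing.Theory.
Local Open Scope classical_set_scope.
Local Open Scope ring_scope.

Section Ideals.
Context {R : comNzRingType}.
Implicit Types (I J M : set R) (a b c i r : R).

(* [comNzRingType] carries no unit predicate; [GRing.unit] would require a
   [comUnitRingType]. *)
Definition nonunit a : Prop := ~ exists b, a * b = 1.

(* [idealr_closed] includes [1 \notin I]. Subsets are Prop-valued, so no
   decidability of membership is assumed. *)
Definition is_proper_ideal I : Prop := idealr_closed (mem I).

Definition maximal_ideal M : Prop :=
  is_proper_ideal M /\
  forall J, is_proper_ideal J -> M `<=` J -> J = M.

Definition radical I : set R :=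
  [set a | exists2 n : nat, (0 < n)%N & a ^+ n \in I].

Definition ann i : set R := [set r | r * i = 0].

Definition weakly_1_absorbing_primary I : Prop :=
  is_proper_ideal I /\
  forall a b c, nonunit a -> nonunit b -> nonunit c ->
    0 <> a * b * c -> a * b * c \in I -> a * b \in I \/ c \in radical I.

Definition weakly_primary I : Prop :=
  is_proper_ideal I /\
  forall a b, 0 <> a * b -> a * b \in I -> a \in I \/ b \in radical I.

End Ideals.

Definition quasilocal (R : comNzRingType) : Prop :=
  exists! M : set R, maximal_ideal M.

(* Main.v *)
(** If the nonunits of [R] were closed under addition they would form its only
maximal ideal; so, [R] not being quasilocal, [x + y = 1] for some nonunits
[x] and [y].  Let [0 <> a b] lie in the weakly 1-absorbing primary ideal [I],
with [a] and [b] nonunits and [b] not in the radical of [I].  Every nonunit [m]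
with [m a b <> 0] satisfies [m a] in [I].  If this applies to both [x] and [y],
then [a = x a + y a] is in [I].  Otherwise, say, [x a b = 0], so [y a b <> 0];
as [ann (a b)] is not maximal, there is [w] outside [ann (a b)] in a proper
ideal containing it.  Then [w] and [x + w] are nonunits not killing [a b], so
[x a = (x + w) a - w a] is in [I], and again [a] is in [I]. *)

Require Import Defs.
From mathcomp Require Import all_boot all_algebra.
From mathcomp Require Import boolp classical_sets.

Set Implicit Arguments.
Unset Strict Implicit.
Unset Printing Implicit Defensive.

Import GRing.Theory.

Section Ideals.
Local Open Scope classical_set_scope.
Local Open Scope ring_scope.
Context {R : comNzRingType}.
Implicit Types (I J M : set R) (a b m x y : R).

Lemma nonunit0 : nonunit (0 : R).
Proof. by case=> b; rewrite mul0r => /eqP; rewrite eq_sym oner_eq0. Qed.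

Lemma nonunitMl a x : nonunit x -> nonunit (a * x).
Proof. by move=> Nx [b axb]; apply: Nx; exists (a * b); rewrite mulrCA mulrA. Qed.

Lemma ideal0 I : is_proper_ideal I -> 0 \in I.
Proof. by case. Qed.

Lemma idealMl I a x : is_proper_ideal I -> x \in I -> a * x \in I.
Proof. by move=> [I0 _ Iax] Ix; rewrite -[a * x]addr0; apply: Iax. Qed.

Lemma idealD I x y : is_proper_ideal I -> x \in I -> y \in I -> x + y \in I.
Proof. by move=> [_ _ Iax] Ix Iy; rewrite -[x]mul1r; apply: Iax. Qed.

Lemma idealDr I x y : is_proper_ideal I -> x \in I -> y + x \in I -> y \in I.
Proof.
move=> [_ _ Iax] Ix Iyx.
by rewrite -[y](addrK x) addrC -mulN1r; apply: Iax.
Qed.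

Lemma proper_ideal_nonunit I x : is_proper_ideal I -> x \in I -> nonunit x.
Proof.
move=> hI Ix [b xb1]; case: (hI) => _ /negP I1 _; apply: I1.
by rewrite -xb1 mulrC; apply: idealMl.
Qed.

Lemma ann_proper_ideal a : a <> 0 -> is_proper_ideal (ann a).
Proof.
move=> a0; split=> /=.
- by rewrite inE /ann /= mul0r.
- by apply/negP; rewrite inE /ann /= mul1r.
- move=> r u v; rewrite !inE /ann /= => ua va.
  by rewrite mulrDl -mulrA ua va mulr0 addr0.
Qed.

(** A proper ideal contains no unit, so [N] contains every proper ideal; this gives both its
    maximality and its uniqueness. *)
Lemma nonunitD_quasilocal :
  (forall x y : R, nonunit x -> nonunit y -> nonunit (x + y)) -> quasilocal R.
Proof.
move=> NunitD; pose N : set R := [set x | nonunit x].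
have hN : is_proper_ideal N.
  split=> /=.
  - by rewrite inE; apply: nonunit0.
  - by apply/negP; rewrite inE; apply; exists 1; rewrite mulr1.
  - move=> r u v; rewrite !inE => Nu Nv.
    by apply: NunitD => //; apply: nonunitMl.
have subN J : is_proper_ideal J -> J `<=` N.
  by move=> hJ x Jx; apply: (proper_ideal_nonunit hJ); rewrite inE.
exists N; split=> [|M [hM maxM]]; last by apply: maxM => //; apply: subN.
by split=> // J hJ NJ; apply/seteqP; split => //; apply: subN.
Qed.

Lemma not_quasilocal_nonunitD1 : ~ quasilocal R ->
  exists x y : R, [/\ nonunit x, nonunit y & x + y = 1].
Proof.
move=> hR; apply: contrapT => noxy; apply/hR/nonunitD_quasilocal => x y Nx Ny.
(* Here [b] is the inverse of [x + y]; scaling by it makes the sum equal to [1]. *)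
move=> [b xyb1]; apply: noxy; exists (b * x), (b * y).
by split; [apply: nonunitMl | apply: nonunitMl | rewrite -mulrDr mulrC].
Qed.

Lemma not_maximal_ideal_properP I : is_proper_ideal I -> ~ maximal_ideal I ->
  exists J w, [/\ is_proper_ideal J, I `<=` J, w \in J & w \notin I].
Proof.
move=> hI nmaxI; apply: contrapT => noJ; apply: nmaxI; split=> // J hJ IJ.
apply/seteqP; split=> // w Jw; apply: contrapT => nIw; apply: noJ.
by exists J, w; split=> //; [rewrite inE | rewrite notin_setE].
Qed.

(** The product is read as that of the two factors [a * b] and [c]. *)
Lemma weakly_primary_weakly_1_absorbing_primary I :
  weakly_primary I -> weakly_1_absorbing_primary I.
Proof. by case=> hI wp; split=> // a b c _ _ _; apply: wp. Qed.

Lemma nonunit_multiplier_mem_ideal I a b :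
    is_proper_ideal I -> ~ quasilocal R -> a * b <> 0 ->
    ~ maximal_ideal (ann (a * b)) ->
    (forall m, nonunit m -> m * (a * b) <> 0 -> m * a \in I) ->
  a \in I.
Proof.
move=> hI hR ab0 nmax multI.
have [x [y [Nx Ny xy1]]] := not_quasilocal_nonunitD1 hR.
(* Stated for [z] and [t] so as to serve for [x], [y] in either order. *)
have split_case z t : nonunit t -> z + t = 1 -> z * (a * b) = 0 -> a \in I.
  move=> Nt zt1 zab0.
  have ta : t * a \in I.
    apply: multI => // tab0; apply: ab0.
    by rewrite -[a * b]mul1r -zt1 mulrDl zab0 tab0 addr0.
  have [J [w [hJ annJ Jw /negP annw]]] :=
    not_maximal_ideal_properP (ann_proper_ideal ab0) nmax.
  have wab0 : w * (a * b) <> 0 by move=> wab0; apply: annw; rewrite inE.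
  have wa : w * a \in I by apply: multI => //; apply: proper_ideal_nonunit Jw.
  (* A sum of nonunits may be a unit, but [z] and [w] both lie in the proper ideal [J], so [z + w]
     is a nonunit. *)
  have Jz : z \in J by rewrite inE; apply: annJ.
  have zwa : (z + w) * a \in I.
    apply: multI; last by rewrite mulrDl zab0 add0r.
    by apply: (proper_ideal_nonunit hJ); apply: idealD.
  have za : z * a \in I by apply: (idealDr hI wa); rewrite -mulrDl.
  by rewrite -[a]mul1r -zt1 mulrDl; apply: idealD.
have [xab0|xab0] := eqVneq (x * (a * b)) 0; first exact: (split_case x y).
have [yab0|yab0] := eqVneq (y * (a * b)) 0.
  by apply: (split_case y x) => //; rewrite addrC.
by rewrite -[a]mul1r -xy1 mulrDl; apply: idealD => //; apply: multI => //; apply/eqP.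
Qed.

Lemma weakly_1_absorbing_primary_weakly_primary I :
    ~ quasilocal R -> (forall i, i \in I -> ~ maximal_ideal (ann i)) ->
  weakly_1_absorbing_primary I -> weakly_primary I.
Proof.
move=> hR hann [hI absI]; split=> // a b /nesym ab0 Iab.
(* Absorption only concerns nonunits: a unit factor puts the other one in [I]. *)
have [[u au1]|Na] := pselect (exists u, a * u = 1).
  right; rewrite inE; exists 1%N => //; rewrite expr1.
  by rewrite -[b]mul1r -au1 (mulrC a) -mulrA; apply: idealMl.
have [[u bu1]|Nb] := pselect (exists u, b * u = 1).
  by left; rewrite -[a]mulr1 -bu1 mulrA mulrC; apply: idealMl.
have [Rb|nRb] := pselect (b \in radical I); first by right.
left; apply: (nonunit_multiplier_mem_ideal hI hR ab0 (hann _ Iab)) => m Nm mab0.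
(* Absorption for the triple [m], [a], [b] leaves only [m * a \in I], since [nRb] excludes the other
   alternative. *)
have [||//|//] := absI m a b Nm Na Nb; rewrite -mulrA; first exact/nesym.
exact: idealMl.
Qed.

End Ideals.

Theorem theorem5 (R : comNzRingType) (I : set R)
  (hR : ~ quasilocal R)
  (hI : is_proper_ideal I)
  (hann : forall i : R, i \in I -> ~ maximal_ideal (ann i)) :
  weakly_1_absorbing_primary I <-> weakly_primary I.
Proof.
split; first exact: weakly_1_absorbing_primary_weakly_primary.
exact: weakly_primary_weakly_1_absorbing_primary.
Qed.
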